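(* Let $B$ be a sparse subset of $[n-1]$ and let $k\ge 0$. The coefficient of $x^k$ in the toric $g$-contribution polynomial $g_{n,|B|}(x)$ is given by each of the following: (a) the number of $(\emptyset,B)$-compatible Dyck words of semilength $n$ that contain exactly $k$ copies of the word $UUD$ as a factor; (b) the number of $123$-avoiding permutations $\pi\in\mathfrak{S}_n$ such that $B\subseteq\operatorname{Asc}(\pi)$ and the inverse permutation $\pi^{-1}$ has exactly $k$ ascents.
   Context: $[n]=\{1,\ldots,n\}$; $C_m=\frac1{m+1}\binom{2m}{m}$. For $0\le j\le n$ the toric $g$-contribution polynomial is $$g_{n,j}(x)=\sum_{k=0}^{\min(\lfloor n/2\rfloor,\,n-j)} C_{n-k-j}\binom{n-k}{k}(x-1)^k.$$ A set of integers is sparse if it contains no two consecutive integers. A Dyck word of semilength $n$ is a word with $n$ letters $U$ and $n$ letters $D$ such that every prefix has at least as many $U$'s as $D$'s. A factor of a word is a contiguous subword. In a labeled Dyck word the letters $U$ are indexed $U_1,\ldots,U_n$ from left to right, and likewise the letters $D$ are indexed $D_1,\ldots,D_n$. A Dyck word of semilength $n$ is $(\emptyset,B)$-compatible if for each $b\in B$ the word $UD_bD_{b+1}$ is a factor (i.e. $D_b$ and $D_{b+1}$ are adjacent and $D_b$ is immediately preceded by some letter $U$). For $\pi\in\mathfrak{S}_n$, $\operatorname{Asc}(\pi)=\{i\in[n-1]:\pi(i)<\pi(i+1)\}$, and elements of $\operatorname{Asc}(\pi)$ are the ascents of $\pi$. $\pi$ is $123$-avoiding if there are no $i_1<i_2<i_3$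 with $\pi(i_1)<\pi(i_2)<\pi(i_3)$. *)

(* Defs.v *)
From mathcomp Require Import all_boot all_order all_algebra all_fingroup.
Set Implicit Arguments. Unset Strict Implicit. Unset Printing Implicit Defensive.
Import GRing.Theory.

(* The division is exact. *)
Definition catalan (m : nat) : nat := 'C(m.*2, m) %/ m.+1.

(* For k in the summation range and j <= n, no subtraction below truncates. *)
Definition toric_g (n j : nat) : {poly int} :=
  (\sum_(0 <= k < (minn n./2 (n - j)).+1)
     (catalan (n - k - j) * 'C(n - k, k))%:R *: ('X - 1) ^+ k)%R.

(* A subset of [n-1] is a B : {set 'I_n} with 0 \notin B; an element b of B
   stands for the integer b itself, with no index shift. *)
Definition subset_n1 (n : nat) (B : {set 'I_n}) : Prop :=
  forall b : 'I_n, b \in B -> 0 < b.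

Definition sparse (n : nat) (B : {set 'I_n}) : Prop :=
  forall b c : 'I_n, b \in B -> c \in B -> nat_of_ord c <> b.+1.

Definition U : bool := true.
Definition D : bool := false.

Definition dyck_word (n : nat) (w : seq bool) : bool :=
  [&& count_mem U w == n, count_mem D w == n &
      all (fun i => count_mem D (take i w) <= count_mem U (take i w))
          (iota 0 (size w).+1)].

(* The pair (l, i) is the letter l with index i; indices start at 1 for each
   of the two letters. *)
Definition labeled (w : seq bool) : seq (bool * nat) :=
  [seq (nth D w p, count_mem (nth D w p) (take p.+1 w)) | p <- iota 0 (size w)].

(* (emptyset, B)-compatibility of a word of semilength n: U_a D_b D_(b+1) is a
   factor of the labeled word for some a (all labels are at most n). *)
Definition compatible (n : nat) (B : {set 'I_n}) (w : seq bool) : bool :=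
  [forall b in B, exists a : 'I_n.+1,
     infix [:: (U, nat_of_ord a); (D, nat_of_ord b); (D, b.+1)] (labeled w)].

Definition occurrences (u w : seq bool) : nat :=
  count (fun p => prefix u (drop p w)) (iota 0 (size w)).

(* 'S_n permutes {0, ..., n-1}, so the value pi(i) of the one-based permutation
   is pi (i - 1) here, up to a shift of values: i in 'I_n is an ascent
   of pi when pi (i - 1) < pi i.  Thus Asc pi is a subset of [n-1] in the
   encoding above. *)
Definition Asc (n : nat) (pi : 'S_n) : {set 'I_n} :=
  [set i : 'I_n | [exists j : 'I_n, (j.+1 == i) && (pi j < pi i)]].

Definition avoids123 (n : nat) (pi : 'S_n) : bool :=
  ~~ [exists i : 'I_n, exists j : 'I_n, exists l : 'I_n,
        [&& i < j, j < l, pi i < pi j & pi j < pi l]].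

(* Main.v *)
Require Import Defs.
From mathcomp Require Import all_boot all_order all_algebra all_fingroup.
From mathcomp Require Import zify ring.
Set Implicit Arguments. Unset Strict Implicit. Unset Printing Implicit Defensive.

(** The idea is to send both families of objects bijectively onto one family
    of Dyck words in which the two kinds of conditions become the same local
    pattern, and then to count that family by contracting the pattern.

    A Dyck word w of semilength n is determined by two bit sequences of length
    n: q tells for each letter D whether a U comes just before it, and u tells
    for each letter U whether another U comes just after it.  Call a position
    where a bit sequence has a 1 immediately followed by a 0 a fall.  The word
    U D_b D_(b+1) is a factor of w exactly when q falls from index b to b + 1,
    and the factors UUD of w are the falls of u.  A 123-avoiding permutation
    pi is determined likewise by the set of those i with i + pi(i) <= n + 1,
    together with the same set for the inverse of pi: pi decreases on such a
    set and on its complement ([avoids123_decr]), so the ascents of pi are the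
    falls of the indicator of the set.  Reading the indicator for the inverse
    backwards and complemented gives the sequence u.

    In both cases the pairs (q, u) that occur are those for which the
    interleaving v = q_1 u_1 q_2 u_2 ... q_n u_n is again a Dyck word
    ([ballot_interleave] translates this into inequalities between partial
    sums).  For Dyck words w, the map w |-> v is an injection of a finite set
    into itself, hence a bijection ([count_encode]).  For permutations,
    surjectivity is proved by constructing pi from the two indicators
    ([encode_perm_surj]).  Hence both numbers in the theorem count the Dyck
    words v such that q falls at B and u has exactly k falls.

    The generating polynomial of these v by number of falls is computed by
    inclusion-exclusion: x^f is the sum of (x - 1)^|A| over the sets A of
    falls of u ([falls_expansion]).  Once A is fixed, v is a Dyck word with
    prescribed patterns U ? D at |A| + |B| places.  As A and B are sparse,
    these patterns overlap only as UUDD.  Replacing U c D by c and deleting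
    UUDD neither creates nor destroys negative heights, so what remains is an
    arbitrary Dyck word of semilength n - |A| - |B| ([ballots_fits2]), and
    their number is a Catalan number ([catalan_ballots]).  There are
    binom(n - k, k) sparse sets A of size k ([sparse_words_bin]), and
    summing over A gives the toric g-contribution polynomial. *)

(** * Words and ballot paths *)

Fixpoint words (n : nat) : seq bitseq :=
  if n is m.+1 then map (cons true) (words m) ++ map (cons false) (words m)
  else [:: [::]].

Lemma mem_words n w : (w \in words n) = (size w == n).
Proof.
elim: n w => [|n IHn] [|x w] //=.
  by rewrite mem_cat; apply/negP => /orP[] /mapP[].
rewrite mem_cat eqSS -IHn; apply/orP/idP => [[] /mapP[v vn [_ ->]] //|wn].
by case: x; [left|right]; apply: map_f.
Qed.

Lemma words_uniq n : uniq (words n).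
Proof.
elim: n => //= n IHn; rewrite cat_uniq !map_inj_uniq ?IHn ?andbT //=;
  try by move=> ? ? [].
by apply/hasPn => _ /mapP[v _ ->]; apply/mapP => -[].
Qed.

Lemma count_wordsS P n : count P (words n.+1) =
  count (fun w => P (true :: w)) (words n) +
  count (fun w => P (false :: w)) (words n).
Proof. by rewrite /= count_cat !count_map. Qed.

Arguments words : simpl never.

Lemma card_words n (P : pred bitseq) :
  #|[set w : n.-tuple bool | P w]| = count P (words n).
Proof.
rewrite cardsE cardE -(size_map val) -size_filter.
apply/perm_size/uniq_perm.
- by rewrite map_inj_uniq ?enum_uniq //; apply: val_inj.
- exact/filter_uniq/words_uniq.
move=> w; rewrite mem_filter mem_words; apply/mapP/andP => [[t]|[Pw /eqP <-]].
  by rewrite mem_enum unfold_in => Pt ->; rewrite size_tuple.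
by exists (in_tuple w); rewrite // mem_enum.
Qed.

(** Lattice paths that start at height [h], never go below 0 and end at 0. *)
Fixpoint ballot (h : nat) (w : bitseq) : bool :=
  if w is x :: w' then
    if x then ballot h.+1 w' else (0 < h) && ballot h.-1 w'
  else h == 0.

Lemma all_iotaS (P : pred nat) n :
  all P (iota 0 n.+1) = P 0 && all (fun i => P i.+1) (iota 0 n).
Proof. by rewrite /= -[1]addn0 iotaDl all_map. Qed.

Lemma count_iotaS (P : pred nat) n :
  count P (iota 0 n.+1) = P 0 + count (fun i => P i.+1) (iota 0 n).
Proof. by rewrite /= -[1]addn0 iotaDl count_map. Qed.

Lemma ballotE h w : ballot h w =
  (count negb w == h + count id w) &&
  all (fun i => count negb (take i w) <= h + count id (take i w))
      (iota 0 (size w).+1).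
Proof.
elim: w h => [|x w IHw] h; first by rewrite /= addn0 eq_sym andbT.
rewrite all_iotaS /=.
case: x => /=.
  rewrite IHw; congr (_ && _); first by lia.
  by apply: eq_all => i /=; lia.
case: h => [|h] /=; last by rewrite IHw; congr (_ && _); lia.
by rewrite take0 /= andbF.
Qed.

Lemma ballot_count h w : ballot h w -> count negb w = h + count id w.
Proof. by rewrite ballotE => /andP[/eqP]. Qed.

Lemma ballot_prefix h x y : ballot h (x ++ y) -> count negb x <= h + count id x.
Proof.
rewrite ballotE => /andP[_ /allP/(_ (size x))].
by rewrite mem_iota size_cat take_size_cat //; apply; lia.
Qed.

Lemma dyck_wordE n (w : n.*2.-tuple bool) : dyck_word n w = ballot 0 w.
Proof.
have EU s : count_mem U s = count id s.
  by apply: eq_count => x /=; rewrite eqb_id.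
have ED s : count_mem D s = count negb s.
  by apply: eq_count => x /=; rewrite eqbF_neg.
rewrite /dyck_word ballotE !EU !ED andbA; congr (_ && _); last first.
  by apply: eq_all => i; rewrite EU ED.
have := count_predC id w; rewrite size_tuple -[count (predC _) _]/(count negb w).
by move: (count id w) (count negb w) => a b; lia.
Qed.

Definition ballots h l := count (ballot h) (words l).

Lemma ballotsS h l : ballots h l.+1 = ballots h.+1 l + (0 < h) * ballots h.-1 l.
Proof.
rewrite /ballots count_wordsS; congr (_ + _).
by case: h => [|h]; rewrite ?mul1n //= mul0n count_pred0.
Qed.

(** The reflection principle, binom(l, d) - binom(l, d - 1) for paths of length
    l = h + 2d, proved by Pascal's rule.  The factor [0 < d] replaces the
    convention that binom(l, -1) vanishes. *)
Lemma ballots_bin h d :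
  ballots h (h + d.*2) + (0 < d) * 'C(h + d.*2, d.-1) = 'C(h + d.*2, d).
Proof.
move El: (h + d.*2) => l; elim: l h d El => [|l IHl] h d El.
  by have [-> ->] : h = 0 /\ d = 0 by lia.
rewrite ballotsS.
case: h El => [|h] El.
  case: d El => // d El.
  have := IHl 1 d ltac:(lia).
  (* Both sides of the middle of row l = 2d + 1 agree; this makes the missing
     step below height 0 cancel. *)
  have E : 'C(l, d.+1) = 'C(l, d).
    by rewrite -bin_sub; [congr 'C(_, _)|]; lia.
  rewrite binS E mul1n mul0n addn0 /=.
  case: d El E => [|d] El E; first by rewrite !bin0; lia.
  by rewrite /= !binS; lia.
have := IHl h d ltac:(lia).
case: d El => [|d] El.
  rewrite !bin0 /= => H.
  suff -> : ballots h.+2 l = 0 by lia.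
  apply/eqP; rewrite -leqn0 leqNgt -has_count; apply/hasP => -[w].
  rewrite mem_words => /eqP sw /ballot_count.
  by have := count_size negb w; lia.
have := IHl h.+2 d ltac:(lia).
by case: d El => [|d] El; rewrite !binS ?bin0 /= ?binS; lia.
Qed.

Lemma catalan_ballots m : ballots 0 m.*2 = catalan m.
Proof.
have := ballots_bin 0 m; rewrite add0n => E.
rewrite /catalan -E; case: m E => [//|m] E.
rewrite mul1n /= in E *.
have := mul_bin_left m.+1.*2 m.
have -> : m.+1.*2 - m = m.+2 by lia.
rewrite -E => E2.
set b := ballots _ _ in E E2 *; set c := 'C(_, _) in E E2 *.
have -> : b + c = b * m.+2 by lia.
by rewrite mulnK.
Qed.

(** * Falls and forced patterns *)

(** The default [true] of [head] makes the last letter never a fall. *)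
Fixpoint falls (w : bitseq) : nat :=
  if w is x :: w' then (x && ~~ head true w') + falls w' else 0.

(** The mask [m] marks positions at which [w] has to fall; the other positions
    are free, so that one word fits many masks. *)
Fixpoint fits (m w : bitseq) : bool :=
  if m is a :: m' then
    if w is x :: w' then (a ==> x && ~~ head true w') && fits m' w' else true
  else true.

(** Sparsity, together with the absence of a mark on the last position. *)
Fixpoint spaced (m : bitseq) : bool :=
  if m is a :: m' then (a ==> ~~ head true m') && spaced m' else true.

(** In an interleaving, a fall of one of the two components becomes the pattern
    U ? D, with a letter of the other component in the middle. *)
Fixpoint fits2 (m w : bitseq) : bool :=
  if m is a :: m' then
    if w is x :: w' then (a ==> x && ~~ nth true w' 1) && fits2 m' w' else true
  else true.

(** Besides separating the marks, this excludes marks on the last two positions,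
    where the pattern U ? D would stick out. *)
Fixpoint spaced2 (m : bitseq) : bool :=
  if m is a :: m' then (a ==> ~~ nth true m' 1) && spaced2 m' else true.

Fixpoint interleave (q u : bitseq) : bitseq :=
  if q is x :: q' then
    if u is y :: u' then x :: y :: interleave q' u' else [::]
  else [::].

Fixpoint evens (w : bitseq) : bitseq :=
  if w is x :: _ :: w' then x :: evens w' else [::].

Fixpoint odds (w : bitseq) : bitseq :=
  if w is _ :: y :: w' then y :: odds w' else [::].

Lemma bitseq_ind_pair (P : bitseq -> Prop) :
  P [::] -> (forall x, P [:: x]) -> (forall x y w, P w -> P [:: x, y & w]) ->
  forall w, P w.
Proof.
move=> P0 P1 P2 w; suff : P w /\ (forall x, P (x :: w)) by case.
by elim: w => [|x w [IH1 IH2]]; split=> // y; apply: P2.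
Qed.

Lemma size_evens w : size (evens w) = (size w)./2.
Proof. by elim/bitseq_ind_pair: w => //= x y w ->. Qed.

Lemma size_odds w : size (odds w) = (size w)./2.
Proof. by elim/bitseq_ind_pair: w => //= x y w ->. Qed.

Lemma size_interleave q u : size q = size u ->
  size (interleave q u) = (size q).*2.
Proof. by elim: q u => [|x q IHq] [|y u] //= [/IHq->]. Qed.

Lemma interleaveK w n : size w = n.*2 -> interleave (evens w) (odds w) = w.
Proof.
elim/bitseq_ind_pair: w n => [|x|x y w IHw] [|n] //= [/IHw-> //].
Qed.

Lemma evens_interleave q u : size q = size u -> evens (interleave q u) = q.
Proof. by elim: q u => [|x q IHq] [|y u] //= [/IHq->]. Qed.

Lemma odds_interleave q u : size q = size u -> odds (interleave q u) = u.
Proof. by elim: q u => [|x q IHq] [|y u] //= [/IHq->]. Qed.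

Lemma count_interleave P q u : size q = size u ->
  count P (interleave q u) = count P q + count P u.
Proof. by elim: q u => [|x q IHq] [|y u] //= [/IHq->]; lia. Qed.

Lemma fits_interleave b a w : size b = size a -> size w = (size b).*2 ->
  fits2 (interleave b a) w = fits b (evens w) && fits a (odds w).
Proof.
elim: b a w => [|x b IHb] [|y a] // [|v [|z w]] //= [sba] [sw].
rewrite IHb //.
have Ee : head true (evens w) = nth true w 0.
  by case: (w) sw => [|? [|? ?]] //=; case: (size b).
have Eo : head true (odds w) = nth true w 1.
  by case: (w) sw => [|? [|? ?]] //=; case: (size b).
rewrite /= Ee Eo.
by case: x; case: y; case: v; case: z => //=; rewrite ?andbT ?andbF //;
   case: (nth true w 0); case: (nth true w 1) => //=; rewrite ?andbF.
Qed.

Lemma spaced_interleave b a : size b = size a ->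
  spaced2 (interleave b a) = spaced b && spaced a.
Proof.
elim: b a => [|x b IHb] [|y a] //= [sba].
rewrite IHb //.
case: b a sba {IHb} => [|x' b] [|y' a] //= _; first by case: x; case: y.
by case: x; case: y; case: x'; case: y' => //=; rewrite ?andbT ?andbF.
Qed.

Lemma count_words_false P n : (forall w, ~~ P (true :: w)) ->
  count P (words n.+1) = count (fun w => P (false :: w)) (words n).
Proof.
move=> nP; rewrite count_wordsS (@eq_count _ _ pred0) ?count_pred0 //.
by move=> w; apply: negbTE.
Qed.

Lemma count_words_true P n : (forall w, ~~ P (false :: w)) ->
  count P (words n.+1) = count (fun w => P (true :: w)) (words n).
Proof.
move=> nP; rewrite count_wordsS addnC (@eq_count _ _ pred0) ?count_pred0 //.
by move=> w; apply: negbTE.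
Qed.

(** Contraction of the forced patterns.  A mask with no two marks at distance
    two is a concatenation of blocks 0, 100 and 1100.  They stand for a free
    letter, for U c D with c free, and for UUDD.  From height h, the block
    U c D leads to the same height as the letter c and is admissible exactly
    when c is, while UUDD is always admissible and changes nothing.  So each
    mark just shortens the path by two. *)
Lemma ballots_fits2 h m : spaced2 m ->
  count (fun w => ballot h w && fits2 m w) (words (size m)) =
  ballots h (size m - (count id m).*2) /\ (count id m).*2 <= size m.
Proof.
have [s] := ubnP (size m); elim: s h m => // s IHs h [|[] m] /= sm.
- by move=> _; split=> //; rewrite /ballots /= andbT.
- case: m sm => [|y [|[] m]] //= sm.
  case: y => /= [|gm].
    (* The block 1100. *)
    case: m sm => [|[] m] //= sm gm.
    have [IH1 IH2] := IHs h m ltac:(lia) gm; split; last by lia.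
    rewrite count_words_true; last by move=> w; rewrite /= andbF.
    rewrite count_words_true; last by move=> [|[] [|[] w]]; rewrite /= ?andbF.
    rewrite count_words_false; last by move=> w; rewrite /= andbF.
    rewrite count_words_false; last by move=> w; rewrite /= ?andbF.
    rewrite (_ : _ - _ = size m - (count id m).*2); last by lia.
    by rewrite -IH1; apply: eq_count => w.
  (* The block 100; the letter in the middle is the free one. *)
  have [IH1 IH2] := IHs h.+1 m ltac:(lia) gm; split; last by lia.
  rewrite (_ : _ - _ = (size m - (count id m).*2).+1); last by lia.
  rewrite ballotsS -IH1.
  rewrite count_words_true; last by move=> w; rewrite /= andbF.
  rewrite count_wordsS.
  rewrite count_words_false; last by move=> w; rewrite /= andbF.
  rewrite count_words_false; last by move=> w; rewrite /= andbF.
  congr (_ + _).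
  case: h {IH1} => [|h] /=; first by rewrite mul0n count_pred0.
  by rewrite mul1n -(IHs h m _ gm).1 //; lia.
move=> gm; have [IH1 IH2] := IHs h.+1 m ltac:(lia) gm; split; last by lia.
rewrite add0n subSn // ballotsS count_wordsS /= IH1; congr (_ + _).
case: h {IH1} => [|h] /=; first by rewrite mul0n count_pred0.
by rewrite mul1n /= (IHs h m _ gm).1 //; lia.
Qed.

Definition sparse_words n k :=
  count (fun m => spaced m && (count id m == k)) (words n).

(** Both sides satisfy the recursion obtained by splitting off a leading 0 or a
    leading block 10. *)
Lemma sparse_words_bin n k : sparse_words n k = 'C(n - k, k).
Proof.
rewrite /sparse_words.
have [s] := ubnP n; elim: s n k => // s IHs [|[|n]] k /= sn.
- by case: k.
- by rewrite /= addn0; case: k => [|[|k]].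
rewrite (count_wordsS _ n.+1) IHs //.
rewrite count_wordsS (@eq_count _ _ pred0) ?count_pred0 ?add0n; last by [].
case: k => [|k].
  rewrite (@eq_count _ _ pred0) ?count_pred0; last by move=> w; rewrite /= andbF.
  by rewrite !subn0 !bin0.
rewrite (eq_count (a2 := fun m => spaced m && (count id m == k))); last by [].
rewrite IHs; last by lia.
rewrite !subSS; case: (leqP k n) => kn.
  rewrite (_ : n.+1 - k = (n - k).+1); last by lia.
  by rewrite binS addnC.
have [-> ->] : n.+1 - k = 0 /\ n - k = 0 by lia.
by rewrite !bin0n; case: k kn.
Qed.

Lemma spaced_size m : spaced m -> (count id m).*2 <= size m.
Proof.
have [s] := ubnP (size m); elim: s m => // s IHs [|[] m] //= sm.
  case: m sm => [|[] m] //= sm gm.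
  by have := IHs m ltac:(lia) gm; lia.
by move=> gm; have := IHs m sm gm; lia.
Qed.

(** A fall uses up a 1 and a 0, so falls cannot be adjacent. *)
Lemma fits_spaced m w : size m = size w -> fits m w -> spaced m.
Proof.
elim: m w => [|a m IHm] [|x w] //= [smw] /andP[ax fmw].
rewrite (IHm w) // andbT; case: a ax => //= /andP[_ hw].
case: m w smw fmw hw {IHm} => [|[] m] [|y w] //= _ /andP[/andP[-> //]].
Qed.

(** * The generating polynomial of falls *)

Section GeneratingPolynomial.
Import GRing.Theory.
Local Open Scope ring_scope.

(** Inclusion-exclusion: x = 1 + (x - 1) at each fall, according to whether the
    fall is marked. *)
Lemma falls_expansion (u : bitseq) :
  \sum_(m <- words (size u) | fits m u) ('X - 1) ^+ count id m =
  'X ^+ falls u :> {poly int}.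
Proof.
elim: u => [|x u IHu]; first by rewrite /words big_cons /= big_nil !expr0 addr0.
rewrite [words _](_ : _ =
  map (cons true) (words (size u)) ++ map (cons false) (words (size u))) //.
rewrite big_cat !big_map /= IHu.
case: (boolP (x && _)) => _ /=; last by rewrite big_pred0_eq add0r add0n.
rewrite (eq_bigr (fun m => ('X - 1) * ('X - 1) ^+ count id m)); last first.
  by move=> m _; rewrite -exprS add1n.
by rewrite -big_distrr /= IHu exprS; ring.
Qed.

(** The common value of the two cardinalities in the theorem. *)
Definition fall_count n (b : bitseq) k :=
  count (fun v => [&& ballot 0 v, fits b (evens v) & falls (odds v) == k])
        (words n.*2).

Lemma sumr_const_count (I : Type) (r : seq I) (P : pred I) (V : nmodType) (x : V) :
  \sum_(i <- r | P i) x = x *+ count P r.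
Proof. by rewrite big_const_seq iter_addr_0. Qed.

(** Expanding each x^(number of falls) over the masks of falls and exchanging
    the sums leaves, for each spaced mask, a count of Dyck words with forced
    patterns, that is a Catalan number depending on the size of the mask only. *)
Lemma fall_count_toric_g n (b : bitseq) k : size b = n -> spaced b ->
  (toric_g n (count id b))`_k = Posz (fall_count n b k).
Proof.
move=> sb gb; set j := count id b.
pose W := [seq v <- words n.*2 | ballot 0 v && fits b (evens v)].
have szW v : v \in W -> size v = n.*2.
  by rewrite mem_filter mem_words => /andP[_ /eqP].
suff -> : toric_g n j = \sum_(v <- W) 'X ^+ falls (odds v).
  rewrite coef_sum (eq_bigr (fun v => if falls (odds v) == k then 1 else 0 : int)).
    rewrite -big_mkcond sumr_const_count count_filter /fall_count natz.
    by congr Posz; apply: eq_count => v /=; rewrite andbC -andbA.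
  by move=> v _; rewrite coefXn eq_sym; case: eqP.
transitivity (\sum_(v <- W) \sum_(a <- words n | fits a (odds v))
    ('X - 1) ^+ count id a : {poly int}); last first.
  apply: eq_big_seq => v /szW sv.
  by rewrite -falls_expansion size_odds sv doubleK.
rewrite (exchange_big_dep (fun=> true)) //=.
transitivity (\sum_(a <- words n | spaced a)
   (catalan (n - count id a - j))%:R *: ('X - 1) ^+ count id a : {poly int}); last first.
  rewrite big_mkcond; apply: eq_big_seq => a; rewrite mem_words => /eqP sa.
  rewrite sumr_const_count count_filter scaler_nat.
  have fE : count (predI (fun v => fits a (odds v))
        (fun v => ballot 0 v && fits b (evens v))) (words n.*2) =
      count (fun v => ballot 0 v && fits2 (interleave b a) v) (words n.*2).
    apply: eq_in_count => v; rewrite mem_words => /eqP sv /=.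
    by rewrite fits_interleave ?sb ?sa // andbC andbA.
  case: ifP => ga.
    congr (_ *+ _); rewrite -catalan_ballots fE.
    have [] := @ballots_fits2 0 (interleave b a).
      by rewrite spaced_interleave ?sb ?sa // gb.
    rewrite size_interleave ?sb ?sa // => -> _.
    by rewrite count_interleave ?sb ?sa //; congr (ballots _ _); rewrite -/j; lia.
  rewrite [X in _ *+ X](_ : _ = 0%N) //.
  rewrite -(count_pred0 (words n.*2)).
  apply: eq_in_count => v; rewrite mem_words => /eqP sv /=.
  apply/negP => /andP[fa _].
  by rewrite (fits_spaced _ fa) // ?size_odds ?sv ?doubleK in ga.
(* Hence the range of summation in the toric polynomial is k <= n / 2, which
   is also the range of sizes of spaced masks. *)
have jn : (j <= n./2)%N by have := spaced_size gb; rewrite -/j sb; lia.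
rewrite /toric_g (minn_idPl _) ?big_mkord; last by lia.
pose F c : {poly int} := (catalan (n - c - j))%:R *: ('X - 1) ^+ c.
have aF (i : 'I_(n./2).+1) : (catalan (n - i - j) * 'C(n - i, i))%:R *: ('X - 1) ^+ i
    = \sum_(a <- words n | spaced a && (count id a == i :> nat)) F (count id a).
  rewrite (eq_bigr (fun=> F i)); last by move=> a /andP[_ /eqP->].
  by rewrite sumr_const_count -[count _ _]/(sparse_words n i) sparse_words_bin /F
     !scaler_nat -mulrnA.
rewrite (eq_bigr _ (fun i _ => aF i)) (exchange_big_dep spaced) /=; last first.
  by move=> i a _ /andP[].
rewrite big_seq_cond [RHS]big_seq_cond.
apply: eq_bigr => a /andP[]; rewrite mem_words => /eqP sa ga.
have ca : (count id a < (n./2).+1)%N by have := spaced_size ga; rewrite sa; lia.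
rewrite (big_pred1 (Ordinal ca)) // => i /=.
by rewrite ga -val_eqE /= eq_sym.
Qed.

End GeneratingPolynomial.

(** * Subsets as masks *)

Lemma fits_nth m w : size m = size w ->
  fits m w = all (fun i => nth false m i ==> nth false w i && ~~ nth true w i.+1)
                 (iota 0 (size m)).
Proof.
elim: m w => // a m IHm [|x w] // [smw].
by rewrite [size _]/= all_iotaS /= -nth0 IHm.
Qed.

Lemma falls_nth w :
  falls w = count (fun i => nth false w i && ~~ nth true w i.+1) (iota 0 (size w)).
Proof.
elim: w => // x w IHw; rewrite [size _]/= count_iotaS /= IHw -nth0.
by congr (_ + _).
Qed.

(** The element [b] of [B] is placed at index [b - 1], since positions in a
    sequence are counted from 0. *)
Definition set_mask n (B : {set 'I_n}) : bitseq :=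
  mkseq (fun i => i.+1 \in [seq val b | b <- enum B]) n.

Section Mask.
Variables (n : nat) (B : {set 'I_n}).
Hypothesis hB : subset_n1 B.

Lemma size_mask : size (set_mask B) = n.
Proof. by rewrite size_mkseq. Qed.

Lemma mem_vals (b : 'I_n) : (val b \in [seq val c | c <- enum B]) = (b \in B).
Proof. by rewrite mem_map ?mem_enum //; apply: val_inj. Qed.

Lemma nth_mask i : nth false (set_mask B) i = (i.+1 \in [seq val b | b <- enum B]).
Proof.
case: (ltnP i n) => ni; first by rewrite nth_mkseq.
rewrite nth_default ?size_mask //; apply/esym/mapP => -[b _ /= Eb].
by have := ltn_ord b; lia.
Qed.

Lemma count_mask : count id (set_mask B) = #|B|.
Proof.
rewrite count_map (eq_count (a2 := preim S (mem [seq val b | b <- enum B]))) //.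
rewrite -count_map -[map S _](iotaDl 1 0) -size_filter cardE -(size_map val).
apply/perm_size/uniq_perm; first exact/filter_uniq/iota_uniq.
  by rewrite map_inj_uniq ?enum_uniq //; apply: val_inj.
move=> i; rewrite mem_filter mem_iota; apply/andP/idP => [[] //|iB].
split=> //; case/mapP: iB => b; rewrite mem_enum => /hB b0 ->.
by have := ltn_ord b; move: b0 => /=; lia.
Qed.

Lemma spaced_mask : sparse B -> spaced (set_mask B).
Proof.
move=> sB; suff H m : (forall i, i < size m -> nth false m i ->
    ~~ nth true m i.+1) -> spaced m.
  apply: H => i; rewrite size_mask nth_mask => _ /mapP[b]; rewrite mem_enum => bB Eb.
  case: (ltnP i.+1 n) => [ni|]; last by have := ltn_ord b; move: Eb => /=; lia.
  rewrite (set_nth_default false) ?size_mask // nth_mask.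
  apply/mapP => -[c]; rewrite mem_enum => cB Ec.
  by apply: (sB b c) => //; move: Ec Eb => /=; lia.
elim: m => //= a m IHm H; apply/andP; split.
  by apply/implyP => Ha; have := H 0 isT Ha; rewrite /= nth0.
by apply: IHm => i; apply: (H i.+1).
Qed.

Lemma fits_mask q : size q = n ->
  fits (set_mask B) q = [forall b in B, nth false q b.-1 && ~~ nth true q b].
Proof.
move=> sq; rewrite fits_nth ?size_mask ?sq //; apply/allP/forall_inP => H.
  move=> b bB; have b0 := hB bB; have := H b.-1.
  rewrite nth_mask prednK // mem_vals bB mem_iota; apply.
  by have := ltn_ord b; lia.
move=> i _; rewrite nth_mask; apply/implyP => /mapP[b].
by rewrite mem_enum => /H + Eb; rewrite /= in Eb; rewrite -Eb.
Qed.

End Mask.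

(** * Dyck words encoded by Dyck words *)

(** For each U, whether the next letter is again U.  A final U counts as followed
    by U, so that it cannot complete a factor UUD. *)
Fixpoint after_U (w : bitseq) : bitseq :=
  if w is x :: w' then
    if x then head U w' :: after_U w' else after_U w'
  else [::].

(** For each D, whether the letter before it is U, when [p] is the letter that
    precedes the word. *)
Fixpoint before_D (p : bool) (w : bitseq) : bitseq :=
  if w is x :: w' then
    if x then before_D U w' else p :: before_D D w'
  else [::].

Lemma size_after_U w : size (after_U w) = count id w.
Proof. by elim: w => //= -[] w /= ->. Qed.

Lemma size_before_D p w : size (before_D p w) = count negb w.
Proof. by elim: w p => //= -[] w IHw p /=; rewrite IHw. Qed.

Lemma occurrences_UUD w : occurrences [:: U; U; D] w = falls (after_U w).
Proof.
elim: w => // x w IHw; rewrite /occurrences [size _]/= count_iotaS.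
rewrite -[count _ _]/(occurrences [:: U; U; D] w) IHw.
by case: x; case: w {IHw} => [|[] [|[] w]] //=; rewrite prefix0s.
Qed.

(** The labeling with [u] letters U and [d] letters D already read, in a form
    suited to induction. *)
Fixpoint labels (u d : nat) (w : bitseq) : seq (bool * nat) :=
  if w is x :: w' then
    if x then (U, u.+1) :: labels u.+1 d w' else (D, d.+1) :: labels u d.+1 w'
  else [::].

Lemma labeledE w : labeled w = labels 0 0 w.
Proof.
suff H u d : [seq (nth D w p, (if nth D w p then u else d) +
    count_mem (nth D w p) (take p.+1 w)) | p <- iota 0 (size w)] = labels u d w.
  by rewrite -H; apply: eq_map => p; case: nth.
elim: w u d => // x w IHw u d.
rewrite [size _]/= [iota _ _]/= -[1]addn0 iotaDl map_cons -map_comp /=.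
rewrite take0 /= eqxx addn0.
case: x => /=; rewrite -IHw addn1; congr cons; apply: eq_map => p /=;
 by case: nth; rewrite /= ?addnS ?addSn.
Qed.

Lemma labels_U_le u d w a : (U, a) \in labels u d w -> a <= u + count id w.
Proof.
elim: w u d => // -[] w IHw u d /=; last first.
  by rewrite inE xpair_eqE /= => /IHw.
by rewrite inE xpair_eqE /= => /orP[/eqP->|/IHw]; lia.
Qed.

Lemma nth_before_D w : nth true (before_D D w) 0 = head U w.
Proof. by case: w => [|[] w] //=; elim: w => [|[]]. Qed.

Lemma infixS (T : eqType) (s : seq T) x t :
  infix s (x :: t) = prefix s (x :: t) || infix s t.
Proof. by []. Qed.

(** Keeping the preceding letter [p] in front of the labeled word makes the
    statement inductive: the U of the factor may be the letter just read.  *)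
Lemma infix_labels b p l u d w :
  (exists a, infix [:: (U, a); (D, b); (D, b.+1)] ((p, l) :: labels u d w)) <->
  [&& d < b, nth false (before_D p w) (b - d.+1) &
      ~~ nth true (before_D p w) (b - d)].
Proof.
elim: w p l u d => [|[] w IHw] p l u d.
- split; last by rewrite !nth_nil andbF.
  by case=> a; rewrite /= andbF.
- rewrite [labels _ _ _]/= [before_D _ _]/= -(IHw U u.+1 u.+1 d).
  split=> -[a] H; exists a; move: H.
    by rewrite infixS /= andbF.
  by move=> H; rewrite infixS H orbT.
rewrite [labels _ _ _]/= [before_D _ _]/=; case: (ltngtP b d.+1) => bd.
- split=> // -[a]; rewrite infixS => /orP[|H].
    rewrite /= !xpair_eqE /= => /andP[_ /andP[/eqP Eb]]; lia.
  by have /(_ (ex_intro _ a H)) := (IHw D d.+1 u d.+1).1; lia.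
- have E1 : b - d.+1 = (b - d.+2).+1 by lia.
  have E2 : b - d = (b - d.+1).+1 by lia.
  rewrite E2 [X in nth false _ X]E1 [nth false _ _]/= [nth true _ _]/=.
  have := IHw D d.+1 u d.+1; rewrite bd => <-.
  split=> -[a] H; exists a; move: H.
    rewrite infixS => /orP[|//].
    rewrite /= !xpair_eqE /= => /andP[_ /andP[/eqP Eb]]; lia.
  by move=> H; rewrite infixS H orbT.
subst b; rewrite subnn subSnn [nth false _ _]/= [nth true _ _]/= andTb.
rewrite nth_before_D; split=> [[a]|/andP[Ep]].
  rewrite infixS => /orP[|H]; last first.
    by have /(_ (ex_intro _ a H)) := (IHw D d.+1 u d.+1).1; rewrite ltnn.
  rewrite /= !xpair_eqE => /andP[/andP[/eqP <- _] /andP[_]].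
  by case: w {IHw} => [|[] w].
case: w {IHw} => [|[] w] // _; exists l.
case: p Ep => // _; rewrite infixS; apply/orP; left.
by rewrite /= !eqxx prefix0s.
Qed.

(** From an even starting height, the heights after an odd number of letters are
    odd, and all the other ones differ by one from a neighbour of this kind.  So
    the path stays nonnegative as soon as its odd heights are at least 1, which
    is what the strict inequalities between the partial sums say. *)
Lemma ballot_interleave e q u : size q = size u ->
  ballot e.*2 (interleave q u) =
  all (fun t => count negb (take t u) < e + count id (take t.+1 q))
      (iota 0 (size q)) && (e + count id q == count negb u).
Proof.
elim: q u e => [|x q IHq] [|y u] e //; first by rewrite /= addn0 double_eq0.
move=> [squ]; rewrite [size (_ :: _)]/= all_iotaS /= take0 /= addn0.
case: x; case: y; rewrite /= ?add0n ?addn0.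
- rewrite -doubleS IHq // addn1 /=.
  by apply: (congr2 andb); [apply: eq_all => t|]; lia.
- rewrite IHq // addn1 /=.
  by apply: (congr2 andb); [apply: eq_all => t|]; lia.
- by case: e => [|e] //=; rewrite -doubleS IHq.
by case: e => [|e] //=; rewrite IHq.
Qed.

Definition encode (w : bitseq) : bitseq := interleave (before_D D w) (after_U w).

Definition dyck_words n := [seq w <- words n.*2 | ballot 0 w].

Lemma dyck_wordsP n w : reflect [/\ ballot 0 w, count id w = n & count negb w = n]
  (w \in dyck_words n).
Proof.
rewrite mem_filter mem_words; apply: (iffP andP) => -[bw].
  have := count_predC id w; rewrite -[count (predC _) _]/(count negb w).
  by have := ballot_count bw => + + /eqP; split=> //; lia.
move=> Ei En; split=> //; have := count_predC id w.
by rewrite -[count (predC _) _]/(count negb w); lia.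
Qed.

Lemma split_at_U t w : t < count id w ->
  exists x y, w = x ++ U :: y /\ count id x = t.
Proof.
elim: w t => [|[] w IHw] // t; last first.
  by move=> /IHw[x [y [-> <-]]]; exists (D :: x), y.
case: t => [|t] /=; first by exists [::], w.
by rewrite add1n ltnS => /IHw[x [y [-> <-]]]; exists (U :: x), y.
Qed.

Lemma after_U_cat x y : after_U (x ++ U :: y) = after_U x ++ after_U (U :: y).
Proof. by elim: x => [|[] [|b x] IHx] //=; rewrite -IHx. Qed.

Lemma before_D_cat p x y :
  before_D p (x ++ U :: y) = before_D p x ++ before_D U y.
Proof. by elim: x p => [|[] x IHx] p //=; rewrite IHx. Qed.

(** Both sides count the peaks, that is the factors UD; a peak may start at the
    letter [p] that precedes the word. *)
Lemma count_before_D p w :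
  count id (before_D p w) = (p && ~~ head U w) + count negb (after_U w).
Proof.
elim: w p => [|[] w IHw] p /=; rewrite ?andbF ?andbT // IHw //.
Qed.

Lemma before_D_head w : 0 < count negb w ->
  exists s, before_D U w = U :: s.
Proof. by elim: w => [|[] w IHw] //=; eexists. Qed.

(** Stop reading w before its letter of index t + 1 among the U's.  The peaks met
    so far account for all the zeros among the first t bits of [after_U] and for
    as many ones among the bits of [before_D] read so far, which are at most t.
    The next D follows a U, which supplies the required additional one. *)
Lemma encode_dyck n w : w \in dyck_words n -> encode w \in dyck_words n.
Proof.
move=> /dyck_wordsP[bw wU wD].
have sqn : size (before_D D w) = n by rewrite size_before_D.
have squ : size (before_D D w) = size (after_U w).
  by rewrite sqn size_after_U wU.
rewrite mem_filter mem_words size_interleave // sqn eqxx andbT.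
rewrite -[0]/(0.*2) ballot_interleave // count_before_D eqxx andbT.
apply/allP => t; rewrite mem_iota sqn => /andP[_ tn].
have [x [y [Ew xt]]] : exists x y, w = x ++ U :: y /\ count id x = t.
  by apply: split_at_U; rewrite wU.
have xD : count negb x <= t.
  by rewrite Ew in bw; have := ballot_prefix bw; rewrite xt.
have yD : 0 < count negb y by move: wD; rewrite Ew count_cat /=; lia.
have [s Es] := before_D_head yD.
rewrite Ew after_U_cat before_D_cat take_size_cat ?size_after_U // Es.
rewrite take_cat size_before_D [t.+1 < _]ltnNge (leq_trans xD (leqnSn t)).
rewrite subSn //= count_cat /=.
by rewrite count_before_D /=; lia.
Qed.

(** The word can be read off from left to right: the bit of [after_U] for a U, or
    the next bit of [before_D] for a D, tells which letter comes next. *)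
Lemma encode_inj_from p w w' : size w = size w' ->
  after_U (p :: w) = after_U (p :: w') -> before_D p w = before_D p w' -> w = w'.
Proof.
elim: w w' p => [|c w IHw] [|c' w'] //= p [sw].
have Ec : after_U (p :: c :: w) = after_U (p :: c' :: w') ->
    before_D p (c :: w) = before_D p (c' :: w') -> c = c'.
  case: p => [[] //|_ Eb].
  by rewrite -[c]/(head U (c :: w)) -[c']/(head U (c' :: w')) -!nth_before_D Eb.
move=> Ea Eb; have {Ec} Ec := Ec Ea Eb; subst c'; congr cons.
apply: (IHw w' c) => //; first by move: Ea; case: p {Eb} => //= -[].
by case: c Ea Eb => //= _ [].
Qed.

Lemma encode_inj n : {in dyck_words n &, injective encode}.
Proof.
move=> w w' /dyck_wordsP[bw wU wD] /dyck_wordsP[bw' wU' wD'] Ee.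
have sz v : count id v = n -> count negb v = n ->
    size (before_D D v) = size (after_U v).
  by rewrite size_before_D size_after_U => -> ->.
apply: (@encode_inj_from D).
- by rewrite -(count_predC id w) -(count_predC id w') wU wU'; congr (_ + _);
    rewrite -[LHS]/(count negb w) wD.
- rewrite /= -[LHS](odds_interleave (sz _ wU wD)).
  by rewrite -[RHS](odds_interleave (sz _ wU' wD')); congr odds.
rewrite -[LHS](evens_interleave (sz _ wU wD)).
by rewrite -[RHS](evens_interleave (sz _ wU' wD')); congr evens.
Qed.

(** An injective map from a finite set to itself permutes it, so the encoding
    need not be inverted. *)
Lemma count_encode n P :
  count (fun w => P (encode w)) (dyck_words n) = count P (dyck_words n).
Proof.
rewrite -(count_map encode P); apply/seq.permP; apply: uniq_perm.
- by rewrite map_inj_in_uniq ?filter_uniq ?words_uniq //; apply: encode_inj.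
- exact/filter_uniq/words_uniq.
have [] // := @uniq_min_size _ (map encode (dyck_words n)) (dyck_words n).
- by rewrite map_inj_in_uniq ?filter_uniq ?words_uniq //; apply: encode_inj.
- by move=> _ /mapP[w Dw ->]; apply: encode_dyck.
by rewrite size_map.
Qed.

Lemma fall_countE n b k : fall_count n b k =
  count (fun v => fits b (evens v) && (falls (odds v) == k)) (dyck_words n).
Proof. by rewrite count_filter; apply: eq_count => v /=; rewrite andbC. Qed.

Lemma compatible_fits n (B : {set 'I_n}) w : subset_n1 B ->
  count id w = n -> count negb w = n ->
  compatible B w = fits (set_mask B) (before_D D w).
Proof.
move=> hB wU wD; rewrite fits_mask ?size_before_D //.
apply: eq_forallb_in => b bB; rewrite labeledE.
have := infix_labels b D 0 0 0 w; rewrite subn0 subn1 (hB b bB) andTb => H.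
apply/existsP/idP => [[a Ha]|/H[a]].
  by apply/H; exists a; rewrite infixS Ha orbT.
rewrite infixS => /orP[//|Ha].
(* Compatibility only speaks of labels a up to n, but there are no others. *)
have aw : a < n.+1.
  rewrite ltnS -[n]add0n -wU; apply: (@labels_U_le 0 0 w).
  exact: (mem_infix Ha (mem_head _ _)).
by exists (Ordinal aw).
Qed.

Lemma compatible_words n (B : {set 'I_n}) k : subset_n1 B ->
  #|[set w : n.*2.-tuple bool |
       [&& dyck_word n w, compatible B w & occurrences [:: U; U; D] w == k]]| =
  fall_count n (set_mask B) k.
Proof.
move=> hB; rewrite fall_countE -count_encode count_filter -card_words.
rewrite !cardsE; apply: eq_card => w; rewrite !unfold_in /= dyck_wordE andbC.
rewrite [RHS]andbC; case: (boolP (ballot 0 w)) => bw; last by rewrite andbC.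
have [_ wU wD] : [/\ ballot 0 w, count id w = n & count negb w = n].
  by apply/dyck_wordsP; rewrite mem_filter bw mem_words size_tuple eqxx.
rewrite andbT (compatible_fits hB) // occurrences_UUD.
have sz : size (before_D D w) = size (after_U w).
  by rewrite size_before_D size_after_U wU wD.
by rewrite /encode evens_interleave // odds_interleave.
Qed.

(** * Permutations encoded by Dyck words *)

Lemma card_ord_count n (P : pred nat) :
  #|[set i : 'I_n | P i]| = count P (iota 0 n).
Proof. by rewrite cardsE cardE size_filter -enumT -val_enum_ord count_map. Qed.

Lemma count_iota_lt n t (P : pred nat) : t <= n ->
  count (fun i => (i < t) && P i) (iota 0 n) = count P (iota 0 t).
Proof.
move=> tn; rewrite -[n in LHS](subnKC tn) iotaD count_cat add0n.
rewrite [X in _ + X](_ : _ = 0) ?addn0.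
  by apply: eq_in_count => i; rewrite mem_iota => /andP[_ ->].
rewrite -(count_pred0 (iota t (n - t))); apply: eq_in_count => i.
by rewrite mem_iota leqNgt => /andP[/negbTE-> _].
Qed.

Lemma card_ord_lt n t : t <= n -> #|[set i : 'I_n | i < t]| = t.
Proof.
move=> tn; rewrite (card_ord_count n (fun i => i < t)).
rewrite (eq_count (a2 := fun i => (i < t) && predT i)); last first.
  by move=> i; rewrite andbT.
by rewrite count_iota_lt // count_predT size_iota.
Qed.

Lemma card_ord_ge n t : t <= n -> #|[set i : 'I_n | t <= i]| = n - t.
Proof.
move=> tn; have := cardsC [set i : 'I_n | i < t].
rewrite card_ord card_ord_lt // (_ : ~: _ = [set i : 'I_n | t <= i]); first by lia.
by apply/setP => i; rewrite !inE -leqNgt.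
Qed.

Section Perm.
Variable n : nat.
Implicit Types (pi : 'S_n) (i j l : 'I_n).

(** With values and positions counted from 1 this is i + pi(i) <= n + 1.  For a
    123-avoiding permutation these are the positions of the left-to-right minima;
    the inequality makes the symmetry under inversion and the counting in
    [encode_perm_dyck] immediate. *)
Definition low pi i := i + pi i < n.

Definition low_word pi : bitseq := [seq low pi i | i <- enum 'I_n].

Lemma size_low_word pi : size (low_word pi) = n.
Proof. by rewrite size_map size_enum_ord. Qed.

Lemma nth_low_word x pi i : nth x (low_word pi) i = low pi i.
Proof. by rewrite (nth_map i) ?size_enum_ord // nth_ord_enum. Qed.

Lemma card_preim pi (P : pred 'I_n) : #|[set i | P (pi i)]| = #|[set i | P i]|.
Proof.
rewrite -[RHS](card_preimset _ (@perm_inj _ pi)).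
by congr #|pred_of_set _|; apply/setP => i; rewrite !inE.
Qed.

Lemma avoids123_inv pi : avoids123 pi -> avoids123 (pi^-1)%g.
Proof.
apply: contra => /existsP[i /existsP[j /existsP[l /and4P[ij jl pij pjl]]]].
apply/existsP; exists ((pi^-1)%g i); apply/existsP; exists ((pi^-1)%g j).
by apply/existsP; exists ((pi^-1)%g l); rewrite !permKV; apply/and4P.
Qed.

Lemma perm_neq pi i j : i < j -> pi i <> pi j :> nat.
Proof. by move=> ij /val_inj/perm_inj eij; rewrite eij ltnn in ij. Qed.

(** If pi(i) < pi(j) with i < j both low, there are too many values above pi(j)
    for all of them to stand before j, as position i is taken by a smaller one;
    a larger value after j completes a pattern 123.  If i and j are both not
    low, there are symmetrically too many values below pi(i) for all of them to
    stand after i. *)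
Lemma avoids123_decr pi i j :
  avoids123 pi -> i < j -> low pi i = low pi j -> pi j < pi i.
Proof.
move=> av ij Eij; rewrite ltnNge; apply/negP => pij.
have {}pij : pi i < pi j by have := perm_neq (pi := pi) ij; lia.
case: (boolP (low pi j)) Eij => [lj Eij|lj /negbT li].
  have : ~~ ([set l | pi j < pi l] \subset [set l : 'I_n | l < j] :\ i).
    apply/negP => /subset_leq_card; apply/negP; rewrite -ltnNge.
    rewrite (card_preim pi (fun l => pi j < l)) card_ord_ge ?ltn_ord //.
    have := cardsD1 i [set l : 'I_n | l < j].
    rewrite inE ij (card_ord_lt (ltnW (ltn_ord j))).
    move: lj; rewrite /low add1n; have := ltn_ord (pi j).
    by set c := #|pred_of_set (_ :\ _)|; move: c (nat_of_ord (pi j)) => c p; lia.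
  case/subsetPn => l; rewrite !inE => pjl; rewrite negb_and negbK -leqNgt => lij.
  case/negP: av; apply/existsP; exists i; apply/existsP; exists j; apply/existsP.
  exists l; rewrite ij pij pjl !andbT /=.
  case/orP: lij => [/eqP Eli|]; first by rewrite Eli in pjl; lia.
  rewrite leq_eqVlt => /orP[/eqP/val_inj Elj|//].
  by rewrite Elj ltnn in pjl.
have : ~~ ([set l | pi l < pi i] \subset [set l : 'I_n | i < l] :\ j).
  apply/negP => /subset_leq_card; apply/negP; rewrite -ltnNge.
  rewrite (card_preim pi (fun l => l < pi i)) (card_ord_lt (ltnW (ltn_ord _))).
  have := cardsD1 j [set l : 'I_n | i < l]; rewrite inE ij card_ord_ge ?ltn_ord //.
  move: li; rewrite /low add1n; have := ltn_ord j.
  by set c := #|pred_of_set (_ :\ _)|; move: c (nat_of_ord (pi i)) => c p; lia.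
case/subsetPn => l; rewrite !inE => pjl; rewrite negb_and negbK -leqNgt => lij.
case/negP: av; apply/existsP; exists l; apply/existsP; exists i; apply/existsP.
exists j; rewrite ij pij pjl !andbT /=.
case/orP: lij => [/eqP Eli|]; first by rewrite Eli in pjl; lia.
rewrite leq_eqVlt => /orP[/eqP/val_inj Elj|//].
by rewrite Elj ltnn in pjl.
Qed.

(** Neighbouring positions in the same class form a descent; otherwise the two
    inequalities between position plus value and n decide. *)
Lemma ascent_low pi i j : avoids123 pi -> j.+1 = i ->
  (pi j < pi i) = low pi j && ~~ low pi i.
Proof.
move=> av Ej; have ji : j < i by rewrite -Ej.
have := avoids123_decr av ji; have := perm_neq (pi := pi) ji.
by rewrite /low; case: ltnP; case: ltnP => ? ? /= ne de; apply/idP/idP => //;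
  first [lia | have := de erefl; lia].
Qed.

Lemma Asc_pos pi : subset_n1 (Asc pi).
Proof. by move=> b; rewrite inE => /existsP[j /andP[/eqP <-]]. Qed.

Lemma in_Asc pi i j : avoids123 pi -> j.+1 = i ->
  (i \in Asc pi) = low pi j && ~~ low pi i.
Proof.
move=> av Ej; rewrite inE -ascent_low //.
apply/existsP/idP => [[j' /andP[/eqP Ej']]|pij]; last by exists j; rewrite Ej eqxx.
by suff -> : j' = j by []; apply: val_inj => /=; lia.
Qed.

Lemma Asc_fits pi (B : {set 'I_n}) : subset_n1 B -> avoids123 pi ->
  (B \subset Asc pi) = fits (set_mask B) (low_word pi).
Proof.
move=> hB av; rewrite fits_mask ?size_low_word //.
apply/subsetP/forall_inP => H b bB; have b0 := hB b bB.
all: have Pb : b.-1 < n by have := ltn_ord b; lia.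
all: have Eb : (Ordinal Pb).+1 = b by rewrite /= prednK.
all: have := H b bB; rewrite (in_Asc av Eb) nth_low_word.
all: by rewrite -(nth_low_word false pi (Ordinal Pb)).
Qed.

Lemma card_Asc pi : avoids123 pi -> #|Asc pi| = falls (low_word pi).
Proof.
move=> av; rewrite -(count_mask (Asc_pos (pi := pi))) falls_nth size_low_word.
rewrite count_map; apply: eq_in_count => i; rewrite mem_iota add0n => /andP[_ ni] /=.
have [ni1|ni1] := ltnP i.+1 n.
  rewrite (nth_low_word _ _ (Ordinal ni)) (nth_low_word _ _ (Ordinal ni1)).
  by rewrite -(in_Asc (i := Ordinal ni1) av) // -mem_vals.
rewrite [nth true _ _]nth_default ?size_low_word // andbF.
by apply/mapP => -[b _ Eb]; have := ltn_ord b; move: Eb => /=; lia.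
Qed.

Lemma falls_rcons s y : falls (rcons s y) = falls s + (last false s && ~~ y).
Proof.
elim: s => [|x s IHs] /=; first by rewrite andbF.
rewrite IHs; case: s {IHs} => [|z s] /=; last by rewrite addnA.
by rewrite andbF add0n addn0.
Qed.

Lemma falls_rev_negb s : falls (rev (map negb s)) = falls s.
Proof.
elim: s => //= x s IHs; rewrite rev_cons falls_rcons IHs negbK addnC.
congr (nat_of_bool _ + _); rewrite andbC; congr (_ && _).
by case: s {IHs} => //= z s; rewrite rev_cons last_rcons.
Qed.

Lemma size_low_word_inv pi :
  size (low_word pi) = size (rev (map negb (low_word (pi^-1)%g))).
Proof. by rewrite size_rev size_map !size_low_word. Qed.

(** Reversing and complementing the second indicator turns the values of pi
    around, so that the partial sums of both components start from small
    positions and large values. *)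
Definition encode_perm pi : bitseq :=
  interleave (low_word pi) (rev (map negb (low_word (pi^-1)%g))).

Lemma count_low pi (P : pred 'I_n) :
  #|[set v | low (pi^-1)%g v && P v]| = #|[set i | low pi i && P (pi i)]|.
Proof.
rewrite -(card_preim pi); congr #|pred_of_set _|; apply/setP => i.
by rewrite !inE /low permK addnC.
Qed.

Lemma low_wordE pi :
  low_word pi = [seq nth false (low_word pi) k | k <- iota 0 n].
Proof.
by have := mkseq_nth false (low_word pi); rewrite size_low_word.
Qed.

Lemma count_low_word pi (P : pred nat) :
  count (fun k => nth false (low_word pi) k && P k) (iota 0 n) =
  #|[set i | low pi i && P i]|.
Proof.
rewrite -card_ord_count; congr #|pred_of_set _|; apply/setP => i.
by rewrite !inE nth_low_word.
Qed.

Lemma count_take_low pi t : t <= n ->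
  count id (take t (low_word pi)) = #|[set i | low pi i && (i < t)]|.
Proof.
move=> tn; rewrite -(count_low_word pi (fun k => k < t)) [in LHS]low_wordE.
rewrite -map_take take_iota (minn_idPl tn) count_map -(@count_iota_lt n t) //.
by apply: eq_count => k /=; rewrite andbC.
Qed.

Lemma count_drop_low pi t : t <= n ->
  count id (drop t (low_word pi)) = #|[set i | low pi i && (t <= i)]|.
Proof.
move=> tn; apply: (@addnI (count id (take t (low_word pi)))).
rewrite -count_cat cat_take_drop count_take_low //.
rewrite -[in LHS](@take_size _ (low_word pi)) size_low_word count_take_low //.
have <- := cardsID [set i : 'I_n | i < t] [set i | low pi i && (i < n)].
congr (_ + _); congr #|pred_of_set _|; apply/setP => i; rewrite !inE ltn_ord andbT //.
by rewrite -leqNgt andbC.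
Qed.

(** The low positions with value at least n - t lie among the low positions up to
    t.  The inclusion is strict because the t + 1 positions up to t cannot all
    have one of the t largest values, and a position up to t with a smaller value
    is low.  Values are counted from 0 here. *)
Lemma encode_perm_dyck pi : encode_perm pi \in dyck_words n.
Proof.
have su := size_low_word_inv pi.
have En s : count negb (rev (map negb s)) = count id s.
  by rewrite count_rev count_map; apply: eq_count => x /=; rewrite negbK.
rewrite mem_filter mem_words size_interleave // size_low_word eqxx andbT.
rewrite -[0]/(0.*2) ballot_interleave // size_low_word add0n En.
apply/andP; split.
  apply/allP => t; rewrite mem_iota add0n => /andP[_ tn].
  rewrite take_rev size_map -map_drop En size_low_word add0n.
  rewrite count_drop_low ?leq_subr // count_take_low //.
  rewrite (count_low pi (fun v => n - t <= v)).
  apply: proper_card; apply/properP; split.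
    by apply/subsetP => i; rewrite !inE /low; lia.
  have : ~~ ([set i : 'I_n | i < t.+1] \subset [set i | n - t <= pi i]).
    apply/negP => /subset_leq_card.
    rewrite card_ord_lt // (card_preim pi (fun i => n - t <= i)) card_ord_ge ?leq_subr //.
    by rewrite subKn ?ltnn // ltnW.
  case/subsetPn => i; rewrite !inE => it; rewrite -ltnNge => pit.
  by exists i; rewrite !inE /low; lia.
rewrite -[X in X == _](_ : count id (take n (low_word pi)) = _); last first.
  by rewrite take_oversize ?size_low_word.
rewrite -[X in _ == X](_ : count id (take n (low_word (pi^-1)%g)) = _); last first.
  by rewrite take_oversize ?size_low_word.
rewrite !count_take_low // (count_low pi (fun v => v < n)); apply/eqP.
by congr #|pred_of_set _|; apply/setP => i; rewrite !inE !ltn_ord.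
Qed.

End Perm.

Section PermInj.
Variable n : nat.
Implicit Types (pi : 'S_n) (i j l : 'I_n).

Lemma low_inv pi i : low (pi^-1)%g (pi i) = low pi i.
Proof. by rewrite /low permK addnC. Qed.

(** Monotonicity on a class says that the rank of a position in its class
    determines the rank of its value. *)
Lemma card_above_in_class pi i : avoids123 pi ->
  #|[set v | (low (pi^-1)%g v == low pi i) && (pi i < v)]| =
  #|[set j | (low pi j == low pi i) && (j < i)]|.
Proof.
move=> av.
rewrite -(card_preim pi (fun v => (low (pi^-1)%g v == low pi i) && (pi i < v))).
congr #|pred_of_set _|; apply/setP => j; rewrite !inE low_inv.
case: eqP => //= Eji; case: (ltngtP j i) => [ji|ij|/val_inj->].
- by rewrite (avoids123_decr av ji Eji).
- by rewrite ltnNge ltnW // (avoids123_decr av ij).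
by rewrite ltnn.
Qed.

Lemma low_word_inj pi1 pi2 : low_word pi1 = low_word pi2 -> low pi1 =1 low pi2.
Proof. by move=> E i; rewrite -!(nth_low_word false) E. Qed.

(** On each of the two classes a 123-avoiding permutation is the decreasing
    bijection onto the corresponding class of values. *)
Lemma encode_perm_inj : {in @avoids123 n &, injective (@encode_perm n)}.
Proof.
move=> pi1 pi2 av1 av2 Ee.
have su (pi : 'S_n) := size_low_word_inv pi.
have E1 : low_word pi1 = low_word pi2.
  by rewrite -(evens_interleave (su pi1)) -(evens_interleave (su pi2)); congr evens.
have /low_word_inj E2 : low_word (pi1^-1)%g = low_word (pi2^-1)%g.
  apply: (inj_map negb_inj); apply: (can_inj (@revK _)).
  by rewrite -(odds_interleave (su pi1)) -(odds_interleave (su pi2)); congr odds.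
move/low_word_inj: E1 => E1.
apply/permP => i; apply: val_inj; apply/eqP.
have C1 := card_above_in_class i av1; have C2 := card_above_in_class i av2.
have : #|[set v | (low (pi2^-1)%g v == low pi2 i) && (pi1 i < v)]| =
       #|[set v | (low (pi2^-1)%g v == low pi2 i) && (pi2 i < v)]|.
  transitivity #|[set v | (low (pi1^-1)%g v == low pi1 i) && (pi1 i < v)]|.
    by congr #|pred_of_set _|; apply/setP => v; rewrite !inE E2 E1.
  rewrite C1 C2.
  by congr #|pred_of_set _|; apply/setP => v; rewrite !inE !E1.
move=> EC; case: (ltngtP (pi1 i) (pi2 i)) => // lt12.
  have := eq_leq EC; rewrite leqNgt => /negP[]; apply: proper_card.
  apply/properP; split.
    by apply/subsetP => v; rewrite !inE => /andP[-> /=]; apply: ltn_trans.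
  by exists (pi2 i); rewrite !inE ?ltnn ?andbF // lt12 andbT low_inv.
have := eq_leq (esym EC); rewrite leqNgt => /negP[]; apply: proper_card.
apply/properP; split.
  by apply/subsetP => v; rewrite !inE => /andP[-> /=]; apply: ltn_trans.
exists (pi1 i); rewrite !inE ?ltnn ?andbF // lt12 andbT.
by rewrite -E2 low_inv E1.
Qed.

End PermInj.

Section Rank.
Variable f : nat -> bool.

Definition class_rank c t := count (fun j => f j == c) (iota 0 t).

Lemma class_rankS c t : class_rank c t.+1 = class_rank c t + (f t == c).
Proof. by rewrite /class_rank -[t.+1]addn1 iotaD count_cat /= addn0. Qed.

Lemma class_rank_mono c s t : s <= t -> class_rank c s <= class_rank c t.
Proof.
move=> st; rewrite -(subnKC st); elim: (t - s) => [|d IHd]; first by rewrite addn0.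
by rewrite addnS class_rankS; lia.
Qed.

Lemma class_rank_lt s t : s < t -> class_rank (f s) s < class_rank (f s) t.
Proof.
by move=> st; have := class_rank_mono (f s) st; rewrite class_rankS eqxx addn1.
Qed.

Lemma class_rank_sum t : class_rank true t + class_rank false t = t.
Proof. by elim: t => // t IHt; rewrite !class_rankS; case: (f t) => /=; lia. Qed.

Variable n : nat.

(** The sorting permutation that lists first the indices where [f] holds and then
    the others, each in increasing order. *)
Definition rank i := class_rank (f i) i + (if f i then 0 else class_rank true n).

Lemma rank_lt i : i < n -> rank i < n.
Proof.
move=> ni; have := class_rank_lt ni; have := class_rank_sum n; rewrite /rank.
by case: (f i); lia.
Qed.

Lemma rank_lt_true i : i < n -> (rank i < class_rank true n) = f i.
Proof.
move=> ni; have := class_rank_lt ni; rewrite /rank.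
by case: (f i) => /=; lia.
Qed.

Lemma rank_inj i j : i < n -> j < n -> rank i = rank j -> i = j.
Proof.
move=> ni nj E; have Ef : f i = f j by rewrite -!rank_lt_true // E.
have {}E : class_rank (f j) i = class_rank (f j) j.
  by move: E; rewrite /rank Ef => /addIn.
case: (ltngtP i j) => // [ij|ji].
  by have := class_rank_lt ij; rewrite Ef E ltnn.
by have := class_rank_lt ji; rewrite E ltnn.
Qed.

Definition rank_ord (i : 'I_n) : 'I_n := Ordinal (rank_lt (ltn_ord i)).

Lemma rank_ord_inj : injective rank_ord.
Proof. by move=> i j [] /rank_inj E; apply/val_inj/E. Qed.

End Rank.

(** Sorting by [f] followed by the inverse of sorting by [k]. *)
Lemma matching_perm n (f k : nat -> bool) : class_rank f true n = class_rank k true n ->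
  exists rho : 'S_n, forall i : 'I_n,
    f i = k (rho i) /\ class_rank f (f i) i = class_rank k (f i) (rho i).
Proof.
move=> Efk; exists (perm (@rank_ord_inj f n) * (perm (@rank_ord_inj k n))^-1)%g => i.
rewrite permM; set v := fun_of_perm _ (fun_of_perm _ _).
have : rank_ord k v = rank_ord f i.
  by rewrite -[LHS](permE (@rank_ord_inj k n)) /v permKV permE.
move=> /(congr1 val) /= E.
have Ef : f i = k v.
  by rewrite -(@rank_lt_true f n) // -(@rank_lt_true k n) // E Efk.
by split=> //; move: E; rewrite /rank -Ef Efk => /addIn ->.
Qed.

(** Let rho match the ones of q increasingly with the zeros of u, and the zeros
    of q with the ones of u.  The Dyck inequalities between the partial sums say
    precisely that q is 1 at the weak excedances of rho, which are the low
    positions of the permutation pi obtained by turning the values of rho around.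
    Two of the three positions of a pattern 123 would belong to the same class,
    on which pi decreases. *)
Lemma encode_perm_surj n v : v \in dyck_words n ->
  exists2 pi : 'S_n, avoids123 pi & encode_perm pi = v.
Proof.
rewrite mem_filter mem_words => /andP[bv /eqP sv].
have sq : size (evens v) = n by rewrite size_evens sv doubleK.
have su : size (odds v) = n by rewrite size_odds sv doubleK.
pose f i := nth false (evens v) i; pose k i := ~~ nth false (odds v) i.
have countE P (s : bitseq) t : t <= size s ->
    count P (take t s) = count (fun i => P (nth false s i)) (iota 0 t).
  move=> ts; rewrite -{1}[s](mkseq_nth false) -map_take take_iota count_map.
  by rewrite (minn_idPl ts).
have Cf t : t <= n -> count id (take t (evens v)) = class_rank f true t.
  by move=> tn; rewrite countE ?sq //; apply: eq_count => i; rewrite eqb_id.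
have Ck t : t <= n -> count negb (take t (odds v)) = class_rank k true t.
  by move=> tn; rewrite countE ?su //; apply: eq_count => i; rewrite eqb_id.
move: bv; rewrite -(interleaveK sv) -[0]/(0.*2) ballot_interleave ?sq ?su //.
move=> /andP[/allP dom /eqP]; rewrite add0n.
rewrite -{1}[evens v](take_size) -{1}[odds v](take_size) sq su Cf // Ck // => Efk.
have {}dom t : t < n -> class_rank k true t < class_rank f true t.+1.
  by move=> tn; rewrite -Cf // -(Ck t (ltnW tn)); apply: dom; rewrite mem_iota.
have [rho Hrho] := matching_perm Efk.
have fE (i : 'I_n) : f i = (i <= rho i).
  have [Ef Er] := Hrho i; have := ltn_ord i; have := ltn_ord (rho i).
  case: (leqP i (rho i)) => Hi lr li.
    have [//|/negbTE fi] := boolP (f i); move: Er; rewrite fi.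
    have := class_rank_sum f i; have := class_rank_sum k i.
    have := class_rank_mono k false Hi; have := dom _ li.
    by rewrite class_rankS fi /=; lia.
  have [fi|/negbTE//] := boolP (f i); move: Er; rewrite fi.
  have := dom _ lr; have := class_rank_mono f true Hi; lia.
pose pi : 'S_n := (rho * perm (@rev_ord_inj n))%g.
have piE (i : 'I_n) : pi i = rev_ord (rho i) by rewrite permM permE.
have lowE (i : 'I_n) : low pi i = f i.
  by rewrite /low piE fE /=; have := ltn_ord (rho i); lia.
exists pi.
  have decr (i j : 'I_n) : i < j -> f i = f j -> pi j < pi i.
    move=> ij Eij; have [Efi Eri] := Hrho i; have [Efj Erj] := Hrho j.
    have : rho i < rho j.
      rewrite ltnNge; apply/negP => /(class_rank_mono k (f j)).
      by have := class_rank_lt f ij; rewrite -Erj Eri Eij; lia.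
    by rewrite !piE /=; have := ltn_ord (rho j); lia.
  apply/negP => /existsP[i /existsP[j /existsP[l /and4P[ij jl pij pjl]]]].
  case: (boolP (f i == f j)) => [/eqP/(decr _ _ ij)|nij]; first by lia.
  case: (boolP (f j == f l)) => [/eqP/(decr _ _ jl)|njl]; first by lia.
  have /(decr _ _ (ltn_trans ij jl)) : f i = f l.
    by move: nij njl; case: (f i); case: (f j); case: (f l).
  by lia.
congr interleave.
  apply: (@eq_from_nth _ false); first by rewrite size_low_word sq.
  move=> i; rewrite size_low_word => ni.
  by rewrite (nth_low_word false pi (Ordinal ni)) lowE.
apply: (@eq_from_nth _ false); first by rewrite size_rev size_map size_low_word su.
move=> i; rewrite size_rev size_map size_low_word => ni.
rewrite nth_rev (size_map negb) size_low_word // (nth_map false) ?size_low_word; last by lia.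
rewrite (_ : n - i.+1 = rev_ord (Ordinal ni)) // nth_low_word.
have [j Ej] : exists j, rho j = Ordinal ni.
  by exists ((rho^-1)%g (Ordinal ni)); rewrite permKV.
by rewrite -Ej -piE low_inv lowE (Hrho j).1 Ej /k negbK.
Qed.

Lemma perm_words n (B : {set 'I_n}) k : subset_n1 B ->
  #|[set pi : 'S_n | [&& avoids123 pi, B \subset Asc pi &
       #|Asc (pi^-1)%g| == k]]| = fall_count n (set_mask B) k.
Proof.
move=> hB; rewrite fall_countE.
pose P v := fits (set_mask B) (evens v) && (falls (odds v) == k).
rewrite -[RHS]/(count P (dyck_words n)).
have -> : count P (dyck_words n) =
    count P [seq encode_perm pi | pi <- enum (@avoids123 n)].
  apply/seq.permP/uniq_perm.
  - exact/filter_uniq/words_uniq.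
  - rewrite map_inj_in_uniq ?enum_uniq // => pi1 pi2.
    by rewrite !mem_enum; apply: encode_perm_inj.
  move=> v; apply/idP/mapP => [/encode_perm_surj[pi av <-]|[pi _ ->]].
    by exists pi; rewrite ?mem_enum.
  exact: encode_perm_dyck.
rewrite count_map -size_filter cardE; apply/perm_size/uniq_perm.
- exact: enum_uniq.
- exact/filter_uniq/enum_uniq.
move=> pi; rewrite [RHS]mem_filter !mem_enum inE [RHS]andbC.
rewrite -[in RHS]topredE /=; case: (boolP (avoids123 pi)) => [av|_]; last by [].
have su := size_low_word_inv pi.
rewrite /P /encode_perm evens_interleave // odds_interleave // falls_rev_negb.
by rewrite Asc_fits // card_Asc // avoids123_inv.
Qed.

Theorem proposition4p5 (n : nat) (B : {set 'I_n}) (hB : subset_n1 B)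
    (hsparse : sparse B) (k : nat) :
  ((toric_g n #|B|)`_k)%R =
    Posz #|[set w : n.*2.-tuple bool |
             [&& dyck_word n w, compatible B w &
                 occurrences [:: U; U; D] w == k]]|
  /\
  ((toric_g n #|B|)`_k)%R =
    Posz #|[set pi : 'S_n |
             [&& avoids123 pi, B \subset Asc pi &
                 #|Asc (pi^-1)%g| == k]]|.
Proof.
rewrite compatible_words // perm_words // -(count_mask hB).
by rewrite fall_count_toric_g ?size_mask //; apply: spaced_mask.
Qed.
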